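(* Let $\mathscr{X}$ be a Hilbert $C^*$-module over a $C^*$-algebra $\mathscr{A}$ and let $y_1,\dots,y_n\in\mathscr{X}$. Then for all $a_1,\dots,a_n\in\mathscr{A}$, $$\left|\sum_{i=1}^n y_ia_i\right|^2\le \left(\sum_{i=1}^n|a_i|^2\right)\max_{1\le i\le n}\sum_{j=1}^n\|\langle y_i,y_j\rangle\| .$$
   Context: A Hilbert $\mathscr{A}$-module over a $C^*$-algebra $\mathscr{A}$ is a complex linear space $\mathscr{X}$ that is a right $\mathscr{A}$-module with compatible scalar multiplication ($\lambda(xa)=x(\lambda a)=(\lambda x)a$), equipped with an $\mathscr{A}$-valued inner product $\langle\cdot,\cdot\rangle:\mathscr{X}\times\mathscr{X}\to\mathscr{A}$ satisfying: $\langle x,x\rangle\ge 0$, with $\langle x,x\rangle=0$ iff $x=0$; $\langle x,\lambda y+z\rangle=\lambda\langle x,y\rangle+\langle x,z\rangle$; $\langle x,ya\rangle=\langle x,y\rangle a$; $\langle x,y\rangle^*=\langle y,x\rangle$; and complete for the norm $\|x\|=\|\langle x,x\rangle\|^{1/2}$. (The inner product is thus linear in the second variable and conjugate-linear in the first.) For $x\in\mathscr{X}$, $|x|=\langle x,x\rangle^{1/2}\in\mathscr{A}$; for $a\in\mathscr{A}$, $|a|=(a^*a)^{1/2}$. Inequalities are in the usual order on self-adjoint elements of $\mathscr{A}$: $a\le b$ iff $b-a$ is positive. *)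

(* Defs.v *)
From HB Require Import structures.
From mathcomp Require Import all_boot all_order all_algebra.
From mathcomp Require Import all_classical all_reals all_analysis.
From mathcomp Require Export complex.

Set Implicit Arguments.
Unset Strict Implicit.
Unset Printing Implicit Defensive.

Import Order.TTheory GRing.Theory Num.Theory.
Import numFieldNormedType.Exports.
Local Open Scope classical_set_scope.
Local Open Scope ring_scope.
Local Open Scope complex_scope.

(* The complex field is R[i] for R : realType. Norms of complex normed spaces
   take values in R[i], and there 0 <= z means that z is real and
   nonnegative. *)

(* C*-algebras are not assumed to be unital (MathComp has no non-unital rings,
   so the product is a plain binary operation). *)
HB.mixin Record isCStarAlgebra (R : realType) A
    of CompleteNormedModule R[i] A := {
  cmul : A -> A -> A ;
  cstar : A -> A ;
  cmulA : forall a b c, cmul a (cmul b c) = cmul (cmul a b) c ;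
  cmulDl : forall a b c, cmul (a + b) c = cmul a c + cmul b c ;
  cmulDr : forall a b c, cmul a (b + c) = cmul a b + cmul a c ;
  cmulZl : forall (l : R[i]) a b, cmul (l *: a) b = l *: cmul a b ;
  cmulZr : forall (l : R[i]) a b, cmul a (l *: b) = l *: cmul a b ;
  cstarK : forall a, cstar (cstar a) = a ;
  cstarD : forall a b, cstar (a + b) = cstar a + cstar b ;
  cstarZ : forall (l : R[i]) a, cstar (l *: a) = l^* *: cstar a ;
  cstarM : forall a b, cstar (cmul a b) = cmul (cstar b) (cstar a) ;
  norm_cmul : forall a b, `|cmul a b| <= `|a| * `|b| ;
  norm_cstarM : forall a, `|cmul (cstar a) a| = `|a| ^+ 2
}.

#[short(type="cstarAlgebraType")]
HB.structure Definition CStarAlgebra (R : realType) :=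
  {A of isCStarAlgebra R A & CompleteNormedModule R[i] A}.

Section CStarAlgebraTheory.
Context {R : realType} {A : cstarAlgebraType R}.
Implicit Types a b : A.

(* Product of the unitization of A, where (a, l) stands for a + l 1. *)
Definition unitization_mul (p q : A * R[i]) : A * R[i] :=
  (cmul p.1 q.1 + p.2 *: q.1 + q.2 *: p.1, p.2 * q.2).

(* Spectrum relative to the unitization. For unital A it may differ from the
   spectrum in A, but only by the point 0, which is irrelevant to positivity. *)
Definition cspectrum a : set R[i] :=
  [set l | ~ exists q : A * R[i],
      unitization_mul (a, - l) q = (0, 1) /\
      unitization_mul q (a, - l) = (0, 1)].

Definition cpositive a : Prop :=
  cstar a = a /\ (forall l, cspectrum a l -> 0 <= l).

Definition cle a b : Prop := cpositive (b - a).

Definition csquare a : A := cmul a a.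

(* The unique positive square root of a, when a is positive (0 if there is
   none). *)
Definition csqrt a : A := xget 0 [set b | cpositive b /\ csquare b = a].

Definition cabs a : A := csqrt (cmul (cstar a) a).

End CStarAlgebraTheory.

(* The last axiom says that the complete norm carried by X is the one defined
   by the inner product. *)
HB.mixin Record isHilbertModule (R : realType) (A : cstarAlgebraType R) X
    of CompleteNormedModule R[i] X := {
  ract : X -> A -> X ;
  inner : X -> X -> A ;
  ractDl : forall x y a, ract (x + y) a = ract x a + ract y a ;
  ractDr : forall x a b, ract x (a + b) = ract x a + ract x b ;
  ractM : forall x a b, ract x (cmul a b) = ract (ract x a) b ;
  ractZl : forall (l : R[i]) x a, ract (l *: x) a = l *: ract x a ;
  ractZr : forall (l : R[i]) x a, ract x (l *: a) = l *: ract x a ;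
  inner_ge0 : forall x, cpositive (inner x x) ;
  inner_eq0 : forall x, inner x x = 0 <-> x = 0 ;
  innerPr : forall (l : R[i]) x y z,
    inner x (l *: y + z) = l *: inner x y + inner x z ;
  inner_ract : forall x y a, inner x (ract y a) = cmul (inner x y) a ;
  inner_star : forall x y, cstar (inner x y) = inner y x ;
  norm_inner : forall x, `|x| = sqrtC `|inner x x|
}.

#[short(type="hilbertModuleType")]
HB.structure Definition HilbertModule (R : realType) (A : cstarAlgebraType R) :=
  {X of isHilbertModule R A X & CompleteNormedModule R[i] X}.

Definition habs (R : realType) (A : cstarAlgebraType R)
    (X : hilbertModuleType A) (x : X) : A :=
  csqrt (inner x x).

(* Main.v *)
Require Import Defs.
From HB Require Import structures.
From mathcomp Require Import all_boot all_order all_algebra.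
From mathcomp Require Import all_classical all_reals all_analysis.
From mathcomp Require Import ring lra.

(** The elements <y_i, y_j> form a self-adjoint matrix with entries in A, and
    the claim is the Schur test for it: an off-diagonal pair of terms is bounded
    by the arithmetic-geometric inequality
      u* g v + v* g* u <= |g| (u* u + v* v)
    ([upos_cross]), and summing over all pairs bounds the quadratic form
    sum a_i* <y_i, y_j> a_j by the row sums ([schur_test]).

    The substance lies in the order of a C*-algebra.  What is needed is that the
    positive elements form a cone, have positive square roots, and include every
    b* b; the last two are also what makes |x|^2 equal to <x, x> and |a|^2 equal
    to a* a.  Positivity is defined through the spectrum in the unitization, and
    the usual route from the spectrum to the norm goes through the spectral
    radius formula and the Gelfand transform.  A more elementary route is taken
    here.  In a unital C*-algebra call a self-adjoint x positive ([upos]) if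
    |t - x| <= t for some t >= 0.

    - This is a cone by the triangle inequality, and the square root is the
      limit of an explicit iteration ([upos_sqrt]).
    - The square of a self-adjoint contraction c is positive: with
      d = sqrt(1 - c^2), the element u = c + i d is unitary and
      c^2 - 1/2 = (u^2 + u*^2) / 4 has norm at most 1/2
      ([unorm_half_sub_sqr]).
    - [upos] agrees with positivity of the spectrum.  One direction is the
      Neumann series.  For the other ([upos_of_invertible]), let r be the least
      r >= 0 for which x + r is [upos]; if r > 0, then p = x + r is invertible,
      so for small e > 0 the element p - e = p (1 - e p^-1) is a product of two
      commuting elements with square roots, hence the square of a self-adjoint
      one, and r was not least.
    - Finally b* b is positive ([upos_uadjM]): for h = b* b and s = sqrt(h^2)
      the element c = b (s - h) satisfies c* c <= 0, which forces h = s.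

    The unitization carries the norm max(|l|, |L|), where L is left
    multiplication by a + l on A.  It is a C*-norm whether or not A has a unit,
    so the unital theory applies to it and is transported back to A. *)

Import Order.TTheory GRing.Theory Num.Theory.
Import numFieldNormedType.Exports.
Local Open Scope ring_scope.
Local Open Scope complex_scope.

(** * Identities in modules over a commutative ring *)

(** The square-zero extension of K by V is a commutative ring that contains V
    and in which scaling is a product.  Hence an equality of K-linear
    combinations of vectors becomes a commutative ring identity, which makes
    [ring] applicable to it. *)
Definition square_zero_ext (K : comNzRingType) (V : lmodType K) : Type :=
  (K * V)%type.

Section SquareZeroExt.
Context (K : comNzRingType) (V : lmodType K).
Local Notation E := (square_zero_ext K V).
HB.instance Definition _ := GRing.Zmodule.copy E (K * V)%type.

Definition sqz_mul (p q : E) : E := (p.1 * q.1, p.1 *: q.2 + q.1 *: p.2).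
Lemma sqz_mulA : associative sqz_mul.
Proof.
move=> [a x] [b y] [c z]; congr pair => /=; first by rewrite mulrA.
by rewrite !scalerDr !scalerA addrA -(mulrC a c) (mulrC c b).
Qed.

Lemma sqz_mulC : commutative sqz_mul.
Proof. by move=> [a x] [b y]; rewrite /sqz_mul /= mulrC addrC. Qed.

Lemma sqz_mul1 : left_id ((1, 0) : E) sqz_mul.
Proof. by move=> [a x]; rewrite /sqz_mul /= mul1r scale1r scaler0 addr0. Qed.

Lemma sqz_mulDl : left_distributive sqz_mul +%R.
Proof.
move=> [a x] [b y] [c z]; congr pair; rewrite /= ?mulrDl //.
by rewrite scalerDl scalerDr addrACA.
Qed.

Lemma sqz_1_neq0 : ((1, 0) : E) != 0.
Proof. by apply/eqP => -[] /eqP; rewrite oner_eq0. Qed.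

HB.instance Definition _ := GRing.Zmodule_isComNzRing.Build E
  sqz_mulA sqz_mulC sqz_mul1 sqz_mulDl sqz_1_neq0.

Definition sqz_vec (x : V) : E := (0, x).
Definition sqz_scal (l : K) : E := (l, 0).
Lemma sqz_vec_inj : injective sqz_vec. Proof. by move=> x y []. Qed.

Lemma sqz_vec0 : sqz_vec 0 = 0. Proof. by []. Qed.

Lemma sqz_vecD x y : sqz_vec (x + y) = sqz_vec x + sqz_vec y.
Proof. by congr pair; rewrite /= addr0. Qed.

Lemma sqz_vecN x : sqz_vec (- x) = - sqz_vec x.
Proof. by congr pair; rewrite /= oppr0. Qed.

Lemma sqz_vecZ l x : sqz_vec (l *: x) = sqz_scal l * sqz_vec x.
Proof. by congr pair; rewrite /= ?mulr0 ?scale0r ?addr0. Qed.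

Lemma sqz_scal_additive : zmod_morphism sqz_scal.
Proof. by move=> l m; congr pair; rewrite /= ?oppr0 ?addr0. Qed.

HB.instance Definition _ :=
  GRing.isZmodMorphism.Build K E sqz_scal sqz_scal_additive.

Lemma sqz_scal_multiplicative : monoid_morphism sqz_scal.
Proof. by split=> // l m; congr pair; rewrite /= !scaler0 addr0. Qed.

HB.instance Definition _ :=
  GRing.isMonoidMorphism.Build K E sqz_scal sqz_scal_multiplicative.
End SquareZeroExt.

Ltac module := apply: sqz_vec_inj;
  rewrite ?(sqz_vecD, sqz_vecN, sqz_vecZ, sqz_vec0); ring.

(** * Real-valued norms of complex normed spaces *)

Section RealNorm.
Context {R : realType}.

Definition rnorm {V : normedZmodType R[i]} (x : V) : R := complex.Re `|x|.

Context {V : normedZmodType R[i]}.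
Implicit Types x y : V.

Lemma rnormE x : `|x| = (rnorm x)%:C.
Proof.
have := normr_ge0 x; rewrite /rnorm; case: `|x| => a b.
by rewrite lecE /= => /andP[/eqP->].
Qed.

Lemma rnorm_ge0 x : 0 <= rnorm x.
Proof. by have := normr_ge0 x; rewrite rnormE lecR. Qed.

Lemma rnormD x y : rnorm (x + y) <= rnorm x + rnorm y.
Proof. by have := ler_normD x y; rewrite !rnormE -rmorphD lecR. Qed.

Lemma rnormN x : rnorm (- x) = rnorm x.
Proof. by rewrite /rnorm normrN. Qed.

Lemma rnorm_eq0 x : rnorm x = 0 -> x = 0.
Proof. by move=> h; apply/eqP; rewrite -normr_eq0 rnormE h. Qed.

Lemma rnorm0 : rnorm (0 : V) = 0.
Proof. by rewrite /rnorm normr0. Qed.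

End RealNorm.

Section ComplexModulus.
Context {R : realType}.
Lemma rnormM (l m : R[i]) : rnorm (l * m) = rnorm l * rnorm m.
Proof.
have : `|l * m| = `|l| * `|m| := normrM l m.
by rewrite !rnormE -rmorphM => -[].
Qed.

Lemma rnormC_real (r : R) : rnorm r%:C = `|r|.
Proof. by rewrite /rnorm normc_def /= expr0n addr0 sqrtr_sqr. Qed.

Lemma rnormN1 : rnorm (-1 : R[i]) = 1.
Proof. by rewrite /rnorm normrN1. Qed.

Lemma rnormZ (V : normedModType R[i]) (l : R[i]) (x : V) :
  rnorm (l *: x) = rnorm l * rnorm x.
Proof.
have : `|l *: x| = `|l| * `|x| := normrZ l x.
by rewrite !rnormE -rmorphM => -[].
Qed.

Lemma rnorm_conj (l : R[i]) : rnorm (l^*)%R = rnorm l.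
Proof. by rewrite /rnorm norm_conjC. Qed.

Lemma rnorm_Re (l : R[i]) : `|complex.Re l| <= rnorm l.
Proof. by have := normc_ge_Re l; rewrite rnormE lecR. Qed.

Lemma rnorm_Im (l : R[i]) : `|complex.Im l| <= rnorm l.
Proof.
case: l => a b; rewrite /rnorm normc_def /= -sqrtr_sqr ler_wsqrtr //.
by rewrite lerDr sqr_ge0.
Qed.

End ComplexModulus.

(** * Unital C*-algebras *)

(** The norm is real-valued, and completeness is stated for sequences, so that
    no topology has to be put on the carrier.  The inequality
    |x|^2 <= |x* x| is enough to recover both the C*-identity and |x*| = |x|. *)
HB.mixin Record isUnitalCStarAlgebra (R : realType) U
    of GRing.Algebra R[i] U := {
  uadj : U -> U ;
  unorm : U -> R ;
  uadjK : forall x, uadj (uadj x) = x ;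
  uadjD : forall x y, uadj (x + y) = uadj x + uadj y ;
  uadjZ : forall (l : R[i]) x, uadj (l *: x) = (l^*)%R *: uadj x ;
  uadjM : forall x y, uadj (x * y) = uadj y * uadj x ;
  unorm_eq0 : forall x, unorm x = 0 -> x = 0 ;
  unormD : forall x y, unorm (x + y) <= unorm x + unorm y ;
  unormZ : forall (l : R[i]) x, unorm (l *: x) = rnorm l * unorm x ;
  unormM : forall x y, unorm (x * y) <= unorm x * unorm y ;
  unorm_uadj_mul : forall x, unorm x ^+ 2 <= unorm (uadj x * x) ;
  unorm_complete : forall u : nat -> U,
    (forall e, 0 < e -> exists N, forall m n,
       (N <= m)%N -> (N <= n)%N -> unorm (u m - u n) <= e) ->
    exists l, forall e, 0 < e -> exists N, forall n,
       (N <= n)%N -> unorm (u n - l) <= e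
}.

#[short(type="unitalCStarType")]
HB.structure Definition UnitalCStarAlgebra (R : realType) :=
  {U of isUnitalCStarAlgebra R U & GRing.Algebra R[i] U}.

Arguments uadj {R U} : rename.
Arguments unorm {R U} : rename.

Section UnitalCStarTheory.
Context {R : realType} {U : unitalCStarType R}.
Implicit Types x y z b c w : U.
Local Notation sa x := (uadj x = x).

Lemma unormZr (r : R) x : 0 <= r -> unorm (r%:C *: x) = r * unorm x.
Proof. by move=> r0; rewrite unormZ rnormC_real ger0_norm. Qed.

Lemma unormN x : unorm (- x) = unorm x.
Proof. by rewrite -scaleN1r unormZ rnormN1 mul1r. Qed.

Lemma unorm0 : unorm (0 : U) = 0.
Proof. by rewrite -(scale0r (0 : U)) unormZ rnorm0 mul0r. Qed.

Lemma unorm_ge0 x : 0 <= unorm x.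
Proof.
by have := unormD x (- x); rewrite subrr unorm0 unormN; lra.
Qed.

Lemma unormB x y : unorm (x - y) <= unorm x + unorm y.
Proof. by rewrite -(unormN y) unormD. Qed.

Lemma uadj0 : uadj (0 : U) = 0.
Proof. by rewrite -(scale0r (0 : U)) uadjZ rmorph0 !scale0r. Qed.

Lemma uadj1 : uadj (1 : U) = 1.
Proof. by rewrite -[RHS](uadjK (1 : U)) -[uadj 1 in RHS]mulr1 uadjM uadjK mulr1. Qed.

Lemma uadjN x : uadj (- x) = - uadj x.
Proof. by rewrite -scaleN1r uadjZ rmorphN1 scaleN1r. Qed.

Lemma uadjB x y : uadj (x - y) = uadj x - uadj y.
Proof. by rewrite uadjD uadjN. Qed.

Lemma uadjZr (r : R) x : uadj (r%:C *: x) = r%:C *: uadj x.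
Proof. by rewrite uadjZ (conjc_real r : (r%:C)^*%R = _). Qed.

Lemma uadjZi x : uadj ('i *: x) = - ('i *: uadj x).
Proof.
rewrite uadjZ -scaleNr; congr (_ *: _).
by apply/eqP; rewrite eq_complex /= oppr0 !eqxx.
Qed.

Lemma unorm1 : unorm (1 : U) <= 1.
Proof.
have := unorm_uadj_mul (1 : U); rewrite uadj1 mulr1.
have := unorm_ge0 (1 : U); nra.
Qed.

Lemma unorm_scalar (r : R) : 0 <= r -> unorm (r%:C%:A : U) <= r.
Proof. by move=> r0; rewrite unormZr // ler_piMr // unorm1. Qed.

Lemma unorm_uadj x : unorm (uadj x) = unorm x.
Proof.
suff le y : unorm y <= unorm (uadj y).
  by apply/eqP; rewrite eq_le le -{2}(uadjK x) le.
have := unorm_uadj_mul y; have := unormM (uadj y) y.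
have := unorm_ge0 y; rewrite le_eqVlt => /predU1P[<-|y0]; first by rewrite unorm_ge0.
move=> h1 h2; rewrite -(ler_pM2r y0) -expr2; exact: le_trans h2 h1.
Qed.

Lemma uadj_mul_eq0 x : uadj x * x = 0 -> x = 0.
Proof.
move=> h; apply: unorm_eq0; apply/eqP; rewrite -sqrf_eq0 eq_le sqr_ge0 andbT.
by rewrite (le_trans (unorm_uadj_mul x)) // h unorm0.
Qed.

Definition ulim (u : nat -> U) l := forall e : R, 0 < e ->
  exists N, forall n, (N <= n)%N -> unorm (u n - l) <= e.

(** The method of majorants: a bounded real sequence whose increments dominate
    those of [u] is nondecreasing, so it converges and [u] is Cauchy. *)
Lemma majorant_cvg (u : nat -> U) (v : nat -> R) (B : R) :
  (forall n, v n <= B) ->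
  (forall n, unorm (u n.+1 - u n) <= v n.+1 - v n) -> exists l, ulim u l.
Proof.
move=> vB uv.
have vmono : {homo v : m n / (m <= n)%N >-> m <= n}.
  apply: homo_leq => [//|y x z|n]; first exact: le_trans.
  by have := le_trans (unorm_ge0 _) (uv n); lra.
have dist m n : (m <= n)%N -> unorm (u n - u m) <= v n - v m.
  move=> /subnK <-; elim: (n - m)%N => [|k IH]; first by rewrite !subrr unorm0.
  rewrite addSn -(subrKA (u (k + m)%N)).
  apply: le_trans (unormD _ _) _; have := uv (k + m)%N; lra.
apply: unorm_complete => e e0.
have supv : has_sup (range v).
  by split; [exists (v 0%N), 0%N|exists B => _ [n _ <-]].
have [_ [N _ <-] hN] := sup_adherent e0 supv.
have close m n : (N <= m)%N -> (m <= n)%N -> unorm (u n - u m) <= e.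
  move=> Nm mn; apply: le_trans (dist _ _ mn) _.
  have /= : v n <= sup (range v) by apply: ub_le_sup; [case: supv|exists n].
  have := vmono _ _ Nm; lra.
exists N => m n Nm Nn; have [mn|/ltnW nm] := leqP m n; last exact: close.
by rewrite -unormN opprB close.
Qed.

(** This passes identities to the limit of an iteration.  Two consecutive terms
    occur in the bound because the recursion relates [u n] to [u n.+1]. *)
Lemma ulim_eq0 u l z (C : R) : ulim u l ->
  (forall n, unorm z <= C * (unorm (u n - l) + unorm (u n.+1 - l))) -> z = 0.
Proof.
move=> ul zC; apply: unorm_eq0; apply/eqP; rewrite eq_le unorm_ge0 andbT.
have [C0|C0] := lerP C 0.
  by apply: le_trans (zC 0%N) _; rewrite mulr_le0_ge0 // addr_ge0 ?unorm_ge0.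
apply/ler_addgt0Pr => e e0; rewrite add0r.
have C2 : 0 < 2 * C by lra.
have [N hN] := ul (e / (2 * C)) (divr_gt0 e0 C2).
apply: le_trans (zC N) _; have := hN _ (leqnn N); have := hN _ (leqnSn N).
rewrite !ler_pdivlMr //; nra.
Qed.

(** * Neumann series and square roots *)

Definition invertible x := exists y, x * y = 1 /\ y * x = 1.

(** The partial sums of the geometric series are the iterates of
    s |-> 1 + x s, and those of s |-> 1 + |x| s majorize them. *)
Lemma neumann x : unorm x < 1 -> invertible (1 - x).
Proof.
move=> x1; set q := unorm x; have q0 : 0 <= q by exact: unorm_ge0.
pose u n := iter n (fun s => 1 + x * s) 0.
pose v n := iter n (fun s => 1 + q * s) 0.
have vB n : v n <= (1 - q)^-1.
  elim: n => [|n IH] /=; first by rewrite invr_ge0; rewrite -/q in x1; lra.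
  rewrite -/(v n); move: IH; rewrite -[_^-1]mul1r !ler_pdivlMr ?subr_gt0 //.
  rewrite -/q in x1; nra.
have uv n : unorm (u n.+1 - u n) <= v n.+1 - v n.
  elim: n => [|n IH]; first by rewrite /= !mulr0 !addr0 !subr0 unorm1.
  change (unorm ((1 + x * u n.+1) - (1 + x * u n)) <=
    (1 + q * v n.+1) - (1 + q * v n)).
  have -> : 1 + x * u n.+1 - (1 + x * u n) = x * (u n.+1 - u n).
    by rewrite mulrBr; module.
  apply: le_trans (unormM _ _) _; have := ler_wpM2l q0 IH; rewrite -/q; lra.
have [l ul] := majorant_cvg u v _ vB uv.
have ux n : u n * x = x * u n.
  elim: n => [|n IH] /=; rewrite ?mul0r ?mulr0 //.
  by rewrite mulrDl mulrDr mulr1 mul1r -mulrA IH.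
have lE : l - (1 + x * l) = 0.
  apply: (ulim_eq0 _ _ _ (1 + q) ul) => n.
  have -> : l - (1 + x * l) = x * (u n - l) - (u n.+1 - l).
    by rewrite -[u n.+1]/(1 + x * u n) mulrBr; module.
  apply: le_trans (unormB _ _) _; have := unormM x (u n - l); rewrite -/q.
  have := unorm_ge0 (u n - l); have := unorm_ge0 (u n.+1 - l); nra.
have lx : l * x - x * l = 0.
  apply: (ulim_eq0 _ _ _ (2 * q) ul) => n.
  have -> : l * x - x * l = x * (u n - l) - (u n - l) * x.
    by rewrite mulrBr mulrBl ux; module.
  apply: le_trans (unormB _ _) _.
  have := unormM x (u n - l); have := unormM (u n - l) x; rewrite -/q.
  have := unorm_ge0 (u n - l); have := unorm_ge0 (u n.+1 - l); nra.
have l1 : l - x * l = 1 by apply/eqP; rewrite subr_eq -subr_eq0 lE.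
exists l; rewrite mulrBl mulrBr mulr1 mul1r l1; split=> //.
by rewrite -[RHS]l1; move/eqP: lx; rewrite subr_eq0 => /eqP->.
Qed.

(** Here 1 - b is the square root of 1 - w, since b + b = w + b b says that
    (1 - b)^2 = 1 - w.  The map s |-> (w + s^2) / 2 is iterated from 0; its
    majorant s |-> (1 + s^2) / 2 stays below 1 even when |w| = 1, where the map
    is not a contraction.  The iterates are polynomials in w, hence the last
    clause. *)
Lemma half_sqr_fixpoint w : unorm w <= 1 -> exists b,
  [/\ unorm b <= 1, b + b = w + b * b, sa w -> sa b
    & forall z, z * w = w * z -> z * b = b * z].
Proof.
move=> w1.
pose u n := iter n (fun s => (2^-1)%:C *: (w + s * s)) 0.
pose v n := iter n (fun s => 2^-1 * (1 + s * s)) (0 : R).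
have v01 n : 0 <= v n <= 1.
  by elim: n => [|n /andP[v0 v1]] /=; [lra|rewrite -/(v n); nra].
have uv n : unorm (u n) <= v n.
  elim: n => [|n IH]; first by rewrite /= unorm0.
  rewrite [u _]/= [v _]/= -/(u n) -/(v n) unormZr; last by lra.
  have := unormD w (u n * u n); have := unormM (u n) (u n).
  have := unorm_ge0 (u n); nra.
have duv n : unorm (u n.+1 - u n) <= v n.+1 - v n.
  elim: n => [|n IH].
    rewrite /= !mulr0 addr0 subr0 unormZr; lra.
  have -> : u n.+2 - u n.+1 =
      (2^-1)%:C *: (u n.+1 * (u n.+1 - u n) + (u n.+1 - u n) * u n).
    have yE : u n.+1 = (2^-1)%:C *: (w + u n * u n) by [].
    rewrite -[u n.+2]/((2^-1)%:C *: (w + u n.+1 * u n.+1)).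
    move: (u n.+1) yE => y yE.
    by rewrite [X in _ - X = _]yE mulrBr mulrBl; module.
  rewrite unormZr; last by lra.
  rewrite -[v n.+2]/(2^-1 * (1 + v n.+1 * v n.+1)).
  have -> : 2^-1 * (1 + v n.+1 * v n.+1) - v n.+1 =
     2^-1 * ((v n.+1 + v n) * (v n.+1 - v n)).
    by rewrite -[X in _ - X]/(2^-1 * (1 + v n * v n)); ring.
  have dv0 := le_trans (unorm_ge0 _) IH.
  have := unormD (u n.+1 * (u n.+1 - u n)) ((u n.+1 - u n) * u n).
  have := unormM (u n.+1) (u n.+1 - u n); have := unormM (u n.+1 - u n) (u n).
  have := ler_pM (unorm_ge0 _) (unorm_ge0 _) (uv n.+1) IH.
  have := ler_pM (unorm_ge0 _) (unorm_ge0 _) IH (uv n).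
  lra.
have v1 n : v n <= 1 by case/andP: (v01 n).
have [b ub] := majorant_cvg u v 1 v1 duv.
exists b; split.
- apply/ler_addgt0Pr => e e0; have [N hN] := ub e e0.
  have := hN N (leqnn N); have := uv N; have := v1 N.
  have := unormB (u N) (u N - b); rewrite opprB addrC subrK; lra.
- apply/eqP; rewrite -subr_eq0; apply/eqP.
  apply: (ulim_eq0 _ _ _ (2 + unorm b) ub) => n.
  have u2 : u n.+1 + u n.+1 = w + u n * u n.
    rewrite [u n.+1]/= -/(u n) -scalerDl -rmorphD.
    by rewrite (_ : 2^-1 + 2^-1 = 1) ?scale1r //; lra.
  have -> : b + b - (w + b * b) =
     u n * (u n - b) + (u n - b) * b - ((u n.+1 - b) + (u n.+1 - b)).
    have -> : u n.+1 - b + (u n.+1 - b) = w + u n * u n - (b + b).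
      by rewrite -u2; module.
    by rewrite mulrBr mulrBl; module.
  apply: le_trans (unormB _ _) _.
  have := unormD (u n * (u n - b)) ((u n - b) * b).
  have := unormD (u n.+1 - b) (u n.+1 - b).
  have := unormM (u n) (u n - b); have := unormM (u n - b) b.
  have := ler_wpM2r (unorm_ge0 (u n - b)) (le_trans (uv n) (v1 n)).
  have := mulr_ge0 (unorm_ge0 b) (unorm_ge0 (u n.+1 - b)).
  have := unorm_ge0 (u n - b).
  lra.
- move=> wsa; have usa n : sa (u n).
    elim: n => [|n IH]; first exact: uadj0.
    by rewrite [u _]/= -/(u n) uadjZr uadjD uadjM IH wsa.
  apply/eqP; rewrite -subr_eq0; apply/eqP; apply: (ulim_eq0 _ _ _ 2 ub) => n.
  have -> : uadj b - b = (u n - b) - uadj (u n - b).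
    by rewrite uadjB usa; module.
  apply: le_trans (unormB _ _) _; rewrite unorm_uadj.
  have := unorm_ge0 (u n.+1 - b); lra.
- move=> z zw; have zu n : z * u n = u n * z.
    elim: n => [|n IH]; first by rewrite /= mulr0 mul0r.
    rewrite [u _]/= -/(u n) -scalerAr -scalerAl mulrDr mulrDl.
    by rewrite mulrA IH -mulrA IH mulrA zw.
  apply/eqP; rewrite -subr_eq0; apply/eqP.
  apply: (ulim_eq0 _ _ _ (2 * unorm z) ub) => n.
  have -> : z * b - b * z = (u n - b) * z - z * (u n - b).
    by rewrite mulrBr mulrBl zu; module.
  apply: le_trans (unormB _ _) _.
  have := unormM (u n - b) z; have := unormM z (u n - b).
  have := mulr_ge0 (unorm_ge0 z) (unorm_ge0 (u n.+1 - b)); lra.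
Qed.

(** * The positive cone *)

(** Heuristically, the spectrum of a self-adjoint x lies in [0, 2t] exactly when
    |t - x| <= t.  This form of positivity avoids the spectrum, which makes its
    stability under sums immediate. *)
Definition upos x := sa x /\ exists2 t : R, 0 <= t & unorm (t%:C%:A - x) <= t.

Lemma upos0 : upos 0.
Proof. by split; [exact: uadj0|exists 0 => //; rewrite scale0r subrr unorm0]. Qed.

Lemma uposD x y : upos x -> upos y -> upos (x + y).
Proof.
move=> [xsa [s s0 sx]] [ysa [t t0 ty]]; split; first by rewrite uadjD xsa ysa.
exists (s + t); first exact: addr_ge0.
have -> : (s + t)%:C%:A - (x + y) = (s%:C%:A - x) + (t%:C%:A - y).
  by rewrite rmorphD; module.
have := unormD (s%:C%:A - x) (t%:C%:A - y); lra.
Qed.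

Lemma uposZ (r : R) x : 0 <= r -> upos x -> upos (r%:C *: x).
Proof.
move=> r0 [xsa [t t0 tx]]; split; first by rewrite uadjZr xsa.
exists (r * t); first exact: mulr_ge0.
have -> : (r * t)%:C%:A - r%:C *: x = r%:C *: (t%:C%:A - x).
  by rewrite rmorphM; module.
by rewrite unormZr // ler_wpM2l.
Qed.

Lemma scaleVr (r : R) x : 0 < r -> r%:C *: (r^-1%:C *: x) = x.
Proof. by move=> r0; rewrite scalerA -rmorphM divff ?gt_eqF // scale1r. Qed.

(** Rescaling by t reduces to |1 - x| <= 1.  The commutation clause takes the
    place of functional calculus: square roots of commuting elements commute. *)
Lemma upos_sqrt x : upos x -> exists y, [/\ upos y, y * y = x
  & forall z, z * x = x * z -> z * y = y * z].
Proof.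
move=> [xsa [t]]; rewrite le_eqVlt => /predU1P[<-|t0] tx.
  have -> : x = 0.
    apply: unorm_eq0; apply/eqP; rewrite eq_le unorm_ge0 andbT.
    by move: tx; rewrite scale0r sub0r unormN.
  by exists 0; split; [exact: upos0|rewrite mulr0|].
pose w := 1 - t^-1%:C *: x.
have w1 : unorm w <= 1.
  have -> : w = t^-1%:C *: (t%:C%:A - x).
    by rewrite scalerBr scalerA -rmorphM mulVf ?gt_eqF // scale1r.
  by rewrite unormZr ?invr_ge0 ?(ltW t0) // ler_pdivrMl // mulr1.
have wsa : sa w by rewrite uadjB uadj1 uadjZr xsa.
have [b [b1 bE bsa bcomm]] := half_sqr_fixpoint _ w1.
have st0 : 0 <= Num.sqrt t by exact: sqrtr_ge0.
exists ((Num.sqrt t)%:C *: (1 - b)); split.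
- apply: uposZ => //; split; first by rewrite uadjB uadj1 bsa.
  by exists 1 => //; rewrite scale1r subKr.
- rewrite -scalerAl -scalerAr scalerA -rmorphM -expr2 sqr_sqrtr ?ltW //.
  rewrite -[RHS](scaleVr _ _ t0); congr (_ *: _).
  have -> : (1 - b) * (1 - b) = 1 - (b + b) + b * b.
    by rewrite mulrBl !mulrBr !mulr1 !mul1r; module.
  by rewrite bE /w; module.
- move=> z zx; rewrite -scalerAr -scalerAl mulrBr mulrBl mulr1 mul1r bcomm //.
  by rewrite /w mulrBr mulrBl mulr1 mul1r -scalerAr -scalerAl zx.
Qed.

Lemma scaleii x : 'i *: ('i *: x) = - x.
Proof. by rewrite scalerA -expr2 sqr_i scaleN1r. Qed.

(** With d = sqrt(1 - c^2), which commutes with c, the element u = c + i d is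
    unitary and has real part c, as in cos^2 - 1/2 = cos(2 theta) / 2. *)
Lemma unorm_half_sub_sqr c : sa c -> unorm c <= 1 ->
  unorm ((2^-1)%:C%:A - c * c) <= 2^-1.
Proof.
move=> csa c1; have w1 : unorm (c * c) <= 1.
  by have := unormM c c; have := unorm_ge0 c; nra.
have [b [_ bE bsa bc]] := half_sqr_fixpoint _ w1.
have {}bsa : sa b by apply: bsa; rewrite uadjM csa.
have {}bc : c * b = b * c by apply: bc; rewrite mulrA.
pose d := 1 - b.
have dsa : sa d by rewrite uadjB uadj1 bsa.
have cd : d * c = c * d by rewrite mulrBl mulrBr mul1r mulr1 bc.
have d2 : d * d = 1 - c * c.
  have -> : d * d = 1 - (b + b) + b * b.
    by rewrite /d mulrBl !mulrBr !mulr1 !mul1r; module.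
  by rewrite bE; module.
pose u := c + 'i *: d.
have uE : uadj u = c - 'i *: d by rewrite uadjD uadjZi csa dsa.
have uu : uadj u * u = 1.
  rewrite uE mulrBl !mulrDr -!scalerAl -!scalerAr scaleii cd d2; module.
have u1 : unorm u <= 1.
  have := unorm_uadj_mul u; have := unorm1; have := unorm_ge0 u; rewrite uu; nra.
have u2 : unorm (u * u) <= 1 by have := unormM u u; have := unorm_ge0 u; nra.
have -> : (2^-1)%:C%:A - c * c = - ((4^-1)%:C *: (u * u + uadj (u * u))).
  have -> : u * u + uadj (u * u) = 4%:C *: (c * c) - 2%:C%:A.
    rewrite uadjM uE /u !(mulrDl, mulrDr, mulrN, mulNr).
    rewrite -!scalerAl -!scalerAr !scaleii cd d2.
    have -> : (4 : R)%:C = 4%:R by rewrite rmorph_nat.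
    have -> : (2 : R)%:C = 2%:R by rewrite rmorph_nat.
    module.
  rewrite scalerBr !scalerA -!rmorphM opprB.
  have -> : (4^-1 * 4 : R) = 1 by lra.
  have -> : (4^-1 * 2 : R) = 2^-1 by lra.
  by rewrite scale1r.
rewrite unormN unormZr; last by lra.
have := unormD (u * u) (uadj (u * u)); rewrite unorm_uadj; lra.
Qed.

Lemma unorm_sub_sqr c (t : R) : sa c -> unorm (c * c) <= t ->
  unorm ((t / 2)%:C%:A - c * c) <= t / 2.
Proof.
move=> csa ct; have c2t : unorm c ^+ 2 <= t.
  by apply: le_trans ct; have := unorm_uadj_mul c; rewrite csa.
have t0 : 0 <= t by apply: le_trans c2t; rewrite sqr_ge0.
move: t0 c2t {ct}; rewrite le_eqVlt => /predU1P[<-|t0] ct.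
  have -> : c = 0.
    by apply: unorm_eq0; apply/eqP; rewrite -sqrf_eq0 eq_le sqr_ge0 andbT.
  by rewrite mul0r mulr0 scale0r subr0 unorm0.
pose s := Num.sqrt t; have s0 : 0 < s by rewrite sqrtr_gt0.
have s2 : s * s = t by rewrite -expr2 sqr_sqrtr ?ltW.
have := unorm_half_sub_sqr (s^-1%:C *: c); rewrite uadjZr csa => /(_ erefl).
rewrite unormZr ?invr_ge0 ?(ltW s0) // ler_pdivrMl // mulr1.
have -> : unorm c <= s.
  rewrite -(ler_pXn2r (n := 2)) ?nnegrE ?unorm_ge0 ?(ltW s0) //.
  by rewrite [s ^+ 2]expr2 s2.
move=> /(_ isT) h.
have -> : (t / 2)%:C%:A - c * c =
    t%:C *: ((2^-1)%:C%:A - (s^-1%:C *: c) * (s^-1%:C *: c)).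
  rewrite -scalerAl -scalerAr scalerA -rmorphM scalerBr !scalerA -!rmorphM.
  by rewrite -s2 -invfM mulfV ?scale1r // mulf_neq0 // gt_eqF.
by rewrite unormZr ?ler_wpM2l // ltW.
Qed.

Lemma upos_sqr c : sa c -> upos (c * c).
Proof.
move=> csa; split; first by rewrite uadjM csa.
exists (unorm (c * c) / 2); first by rewrite divr_ge0 ?unorm_ge0.
exact: unorm_sub_sqr.
Qed.

(** In the definition of [upos] the constant t can be any bound of the norm.
    This uniformity is what lets [upos] pass to limits. *)
Lemma upos_unorm_sub x (t : R) : upos x -> unorm x <= t ->
  unorm (t%:C%:A - x) <= t.
Proof.
move=> /upos_sqrt[y [[ysa _] <- _]] xt.
have t0 : 0 <= t / 2 by rewrite divr_ge0 // (le_trans (unorm_ge0 _) xt).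
have -> : t%:C%:A - y * y = (t / 2)%:C%:A + ((t / 2)%:C%:A - y * y).
  by rewrite addrA -scalerDl -rmorphD -splitr.
have := unorm_sub_sqr _ _ ysa xt; have := unorm_scalar _ t0.
have := unormD ((t / 2)%:C%:A) ((t / 2)%:C%:A - y * y); lra.
Qed.

Lemma invertibleZ (l : R[i]) x : l != 0 -> invertible x -> invertible (l *: x).
Proof.
move=> l0 [y [xy yx]]; exists (l^-1 *: y).
by rewrite -!scalerAl -!scalerAr !scalerA divff // mulVf // xy yx !scale1r.
Qed.

(** * Positivity and the spectrum *)

(** Since x + r = (t + r) - (t - x) and |t - x| <= t < t + r, the Neumann series
    applies. *)
Lemma upos_invertible x (r : R) : 0 < r -> upos x -> invertible (x + r%:C%:A).
Proof.
move=> r0 [xsa [t t0 tx]]; have tr0 : 0 < t + r by lra.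
rewrite -(scaleVr (t + r) (x + _)) //; apply: invertibleZ.
  by rewrite eq_complex /= gt_eqF.
have -> : (t + r)^-1%:C *: (x + r%:C%:A) = 1 - (t + r)^-1%:C *: (t%:C%:A - x).
  have h1 : (t + r)^-1%:C *: ((t + r)%:C *: (1 : U)) = 1.
    by rewrite scalerA -rmorphM mulVf ?gt_eqF // scale1r.
  by rewrite -[X in _ = X - _]h1 rmorphD; module.
apply: neumann; rewrite unormZr ?invr_ge0 ?(ltW tr0) // ltr_pdivrMl // mulr1; lra.
Qed.

Lemma left_right_invertible x y z : y * x = 1 -> x * z = 1 -> invertible x.
Proof.
move=> yx xz; exists z; split=> //.
by rewrite -[z]mul1r -yx -(mulrA y) xz mulr1.
Qed.

(** The spectrum of a self-adjoint element is real, because (c - i s) (c + i s)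
    is c^2 + s^2, and c^2 is positive. *)
Lemma sa_invertible_im c (s : R) : sa c -> s != 0 ->
  invertible (c + ('i * s%:C)%:A).
Proof.
move=> csa s0.
have s20 : 0 < s ^+ 2 by rewrite exprn_even_gt0.
have [v [xv vx]] := upos_invertible _ _ s20 (upos_sqr _ csa).
pose k : R[i] := 'i * s%:C.
have k2 : k * k = - (s ^+ 2)%:C.
  by rewrite mulrACA -expr2 sqr_i -rmorphM -expr2 mulN1r.
have E1 : (c - k%:A) * (c + k%:A) = c * c + (s ^+ 2)%:C%:A.
  rewrite !(mulrDl, mulrDr, mulNr) -!scalerAl -!scalerAr.
  by rewrite !mul1r !mulr1 !scalerA k2; module.
have E2 : (c + k%:A) * (c - k%:A) = c * c + (s ^+ 2)%:C%:A.
  rewrite !(mulrDl, mulrDr, mulrN) -!scalerAl -!scalerAr.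
  by rewrite !mul1r !mulr1 !scalerA k2; module.
apply: (left_right_invertible _ (v * (c - k%:A)) ((c - k%:A) * v)).
  by rewrite -mulrA E1.
by rewrite mulrA E2.
Qed.

Lemma left_right_inverse_eq x y z : x * y = 1 -> z * x = 1 -> y = z.
Proof. by move=> xy zx; rewrite -[y]mul1r -zx -mulrA xy mulr1. Qed.

(** An invertible positive element stays positive when a small multiple of 1 is
    subtracted: p - d = p (1 - d p^-1) = (z y)^2, where y = sqrt(p) and
    z = sqrt(1 - d p^-1) commute. *)
Lemma upos_invertible_shift p : upos p -> invertible p -> exists2 e : R, 0 < e &
  forall d, 0 <= d <= e -> upos (p - d%:C%:A).
Proof.
move=> ppos [v [pv vp]]; have [psa _] := ppos.
have [y [[ysa _] yy yc]] := upos_sqrt _ ppos.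
have vsa : sa v.
  by apply/esym/(left_right_inverse_eq p) => //; rewrite -[p]psa -uadjM pv uadj1.
have Nv1 : 0 < unorm v + 1 by rewrite ltr_wpDl ?unorm_ge0.
(* For d below this bound |d v| <= 1; the summand 1 avoids dividing by 0. *)
exists (unorm v + 1)^-1; first by rewrite invr_gt0.
move=> d /andP[d0 de].
have epos : upos (1 - d%:C *: v).
  split; first by rewrite uadjB uadj1 uadjZr vsa.
  exists 1 => //; rewrite scale1r subKr unormZr //.
  move: de; rewrite -[_^-1]mul1r ler_pdivlMr //; nra.
have [z [[zsa _] zz zc]] := upos_sqrt _ epos.
have yv : y * v = v * y.
  have py : p * y = y * p by rewrite yc.
  by rewrite -[y in LHS]mul1r -vp -!(mulrA v) py -!mulrA pv mulr1.
have yz : y * z = z * y.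
  by apply: zc; rewrite mulrBr mulrBl mulr1 mul1r -scalerAr -scalerAl yv.
have -> : p - d%:C%:A = (z * y) * (z * y).
  rewrite mulrA -(mulrA z) yz mulrA zz -mulrA yy mulrBl mul1r -scalerAl vp //.
by apply: upos_sqr; rewrite uadjM ysa zsa.
Qed.

(** A self-adjoint element whose spectrum has no negative point is positive.
    The positive translates x + r form a closed half-line of r >= 0; if its
    least element r0 were nonzero, x + r0 would be invertible and
    [upos_invertible_shift] would give a smaller one. *)
Lemma upos_of_invertible x : sa x ->
  (forall r : R, 0 < r -> invertible (x + r%:C%:A)) -> upos x.
Proof.
move=> xsa xinv.
have shift_sa (r : R) : sa (x + r%:C%:A) by rewrite uadjD uadjZr uadj1 xsa.
pose S : set R := [set r | 0 <= r /\ upos (x + r%:C%:A)]%classic.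
have S0 : lbound S 0 by move=> r [].
have SN : S (unorm x).
  split; first exact: unorm_ge0.
  split=> //; exists (unorm x); first exact: unorm_ge0.
  by rewrite opprD addrCA subrr addr0 unormN.
have Sinf : has_inf S by split; [exists (unorm x)|exists 0].
pose r0 := inf S; have r0_ge0 : 0 <= r0 by apply: lb_le_inf => //; case: Sinf.
(* The infimum is attained: T serves as the constant for every r <= r0 + 1. *)
have r0pos : upos (x + r0%:C%:A).
  pose T := unorm x + r0 + 1.
  have T0 : 0 <= T by have := unorm_ge0 x; rewrite /T; lra.
  split=> //; exists T => //; apply/ler_addgt0Pr => e e0.
  have e10 : 0 < Num.min e 1 by rewrite lt_min e0 /=.
  have [r [r_ge0 rpos] re] := inf_adherent e10 Sinf.
  have [re1 re2] : r < r0 + e /\ r < r0 + 1.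
    by move: re; rewrite addr_minr lt_min => /andP[].
  have r0r : r0 <= r by apply: ge_inf => //; exists 0.
  have NT : unorm (x + r%:C%:A) <= T.
    have := unormD x (r%:C%:A); have := unorm_scalar _ r_ge0; rewrite /T; lra.
  have := upos_unorm_sub _ _ rpos NT.
  have -> : T%:C%:A - (x + r0%:C%:A) =
      (T%:C%:A - (x + r%:C%:A)) + (r - r0)%:C%:A by rewrite rmorphB; module.
  have rr0 : 0 <= r - r0 by lra.
  have := unormD (T%:C%:A - (x + r%:C%:A)) ((r - r0)%:C%:A).
  have := unorm_scalar _ rr0; lra.
have [r00|r0gt] := lerP r0 0.
  have r0E : r0 = 0 by lra.
  by move: r0pos; rewrite r0E scale0r addr0.
have [e e0 he] := upos_invertible_shift _ r0pos (xinv _ r0gt).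
pose d := Num.min e r0; have d0 : 0 < d by rewrite lt_min e0.
have : S (r0 - d).
  split; first by rewrite subr_ge0 ge_min lexx orbT.
  have -> : x + (r0 - d)%:C%:A = x + r0%:C%:A - d%:C%:A by rewrite rmorphB; module.
  by apply: he; rewrite (ltW d0) ge_min lexx.
by move=> /(ge_inf (ex_intro _ 0 S0)); rewrite -/r0; lra.
Qed.

(** * Elements of the form b* b *)

(** Apart from 0, b* b and b b* have the same spectrum: if v inverts r - b* b,
    then r^-1 (1 + b v b* ) inverts r - b b*. *)
Lemma upos_opp_mulC_uadj b : upos (- (uadj b * b)) -> upos (- (b * uadj b)).
Proof.
move=> bpos; apply: upos_of_invertible => [|r r0].
  by rewrite uadjN uadjM uadjK.
have rC : r%:C != 0 by rewrite eq_complex /= gt_eqF.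
have [v [xv vx]] := upos_invertible _ _ r0 bpos.
have H1 : (r%:C%:A - b * uadj b) * (1 + b * v * uadj b) = r%:C%:A.
  rewrite mulrBl !mulrDr !mulr1 -scalerAl mul1r.
  have -> : b * uadj b * (b * v * uadj b) = b * (uadj b * b * v) * uadj b.
    by rewrite !mulrA.
  have -> : uadj b * b * v = r%:C *: v - 1.
    by rewrite -xv mulrDl mulNr -scalerAl mul1r; module.
  by rewrite mulrBr mulrBl mulr1 -scalerAr -scalerAl; module.
have H2 : (1 + b * v * uadj b) * (r%:C%:A - b * uadj b) = r%:C%:A.
  rewrite mulrBr !mulrDl !mul1r -scalerAr mulr1.
  have -> : b * v * uadj b * (b * uadj b) = b * (v * (uadj b * b)) * uadj b.
    by rewrite !mulrA.
  have -> : v * (uadj b * b) = r%:C *: v - 1.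
    by rewrite -vx mulrDr mulrN -scalerAr mulr1; module.
  by rewrite mulrBr mulrBl mulr1 -scalerAr -scalerAl; module.
rewrite addrC; apply: (left_right_invertible _ (r%:C^-1 *: (1 + b * v * uadj b))
  (r%:C^-1 *: (1 + b * v * uadj b))).
  by rewrite -scalerAl H2 scalerA mulVf // scale1r.
by rewrite -scalerAr H1 scalerA mulVf // scale1r.
Qed.

(** With p = b + b* and q = i (b - b* ), both self-adjoint, this is half of
    p^2 + q^2. *)
Lemma upos_uadj_sum b : upos (uadj b * b + b * uadj b).
Proof.
pose p := b + uadj b; pose q := 'i *: (b - uadj b).
have psa : sa p by rewrite uadjD uadjK addrC.
have qsa : sa q by rewrite uadjZi uadjB uadjK -scalerN opprB.
have := uposD _ _ (upos_sqr _ psa) (upos_sqr _ qsa).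
have h0 : 0 <= (2^-1 : R) by lra.
move=> /(uposZ _ _ h0); congr upos.
have -> : q * q = - ((b - uadj b) * (b - uadj b)).
  by rewrite -scalerAl -scalerAr scaleii.
have -> : p * p - (b - uadj b) * (b - uadj b) = 2%:C *: (uadj b * b + b * uadj b).
  rewrite !(mulrDl, mulrDr, mulrN, mulNr).
  have -> : (2 : R)%:C = 2%:R by rewrite rmorph_nat.
  module.
rewrite scalerA -rmorphM; have -> : (2^-1 * 2 : R) = 1 by lra.
by rewrite scale1r.
Qed.

(** If f is the square root of - e^2, then e + i f is normal and its square norm
    is |e^2 + f^2| = 0. *)
Lemma upos_opp_sqr e : sa e -> upos (- (e * e)) -> e = 0.
Proof.
move=> esa /upos_sqrt[f [[fsa _] ff fc]].
have ef : e * f = f * e by apply: fc; rewrite mulrN mulNr mulrA.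
have w0 : e + 'i *: f = 0.
  apply: uadj_mul_eq0; rewrite uadjD uadjZi esa fsa.
  rewrite !(mulrDl, mulrDr, mulNr) -!scalerAl -!scalerAr scaleii ef ff; module.
have w0' : e - 'i *: f = 0.
  by rewrite -[e]esa -[f]fsa -uadjZi -uadjD w0 uadj0.
have : 2%:R *: e = 0.
  have -> : 2%:R *: e = (e + 'i *: f) + (e - 'i *: f) by module.
  by rewrite w0 w0' addr0.
by move/eqP; rewrite scaler_eq0 pnatr_eq0 /= => /eqP.
Qed.

(** Let h = b* b, let s = sqrt(h^2) be its absolute value, and k = s - h, twice
    the negative part of h.  As k (s + h) = 0, the element c = b k satisfies
    c* c = k h k = - s k^2 = - (q k)^2 with q = sqrt(s).  So - c* c is positive,
    then so is - c c*, and c* c, the sum of c* c + c c* and - c c*, is positive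
    as well.
    Hence q k = 0, and k = 0 follows. *)
Lemma upos_uadjM b : upos (uadj b * b).
Proof.
pose h := uadj b * b; have hsa : sa h by rewrite uadjM uadjK.
have [s [spos ss sc]] := upos_sqrt _ (upos_sqr _ hsa); have [ssa _] := spos.
have hs : h * s = s * h by apply: sc; rewrite mulrA.
have [q [[qsa _] qq qc]] := upos_sqrt _ spos.
pose k := s - h; have ksa : sa k by rewrite uadjB ssa hsa.
have ks : k * s = s * k by rewrite mulrBl mulrBr hs.
have qk : q * k = k * q by rewrite qc.
have kh : k * h = - (k * s).
  apply/eqP; rewrite -subr_eq0 opprK -mulrDr; apply/eqP.
  by rewrite mulrBl !mulrDr -ss hs; module.
have e0 : q * k = 0.
  have esa : sa (q * k) by rewrite uadjM ksa qsa.
  have cE : uadj (b * k) * (b * k) = - ((q * k) * (q * k)).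
    have -> : uadj (b * k) * (b * k) = (k * h) * k by rewrite uadjM ksa /h !mulrA.
    by rewrite kh mulNr -qq !mulrA -qk.
  apply: upos_opp_sqr => //; rewrite -cE.
  have -> : uadj (b * k) * (b * k) =
     uadj (b * k) * (b * k) + (b * k) * uadj (b * k)
     + - ((b * k) * uadj (b * k)) by module.
  apply: uposD; first exact: upos_uadj_sum.
  by apply: upos_opp_mulC_uadj; rewrite cE opprK; apply: upos_sqr.
have sk : s * k = 0 by rewrite -qq -mulrA e0 mulr0.
have k0 : k = 0.
  apply: uadj_mul_eq0; rewrite ksa {2}/k mulrBr kh ks sk; module.
rewrite -/h (_ : h = s) //; apply/esym/eqP; rewrite -subr_eq0; exact/eqP.
Qed.

(** * The Schur test *)

(** After multiplication by t this is (t x - g y)* (t x - g y) plus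
    y* (t^2 - g* g) y, and t^2 - g* g has a square root because
    |g* g| <= t^2. *)
Lemma upos_cross g x y (t : R) : unorm g <= t ->
  upos (t%:C *: (uadj x * x) + t%:C *: (uadj y * y)
        - (uadj x * g * y + uadj y * uadj g * x)).
Proof.
move=> gt; have : 0 <= t by apply: le_trans gt; exact: unorm_ge0.
rewrite le_eqVlt => /predU1P[t0|t0].
  have -> : g = 0.
    by apply: unorm_eq0; apply/eqP; rewrite eq_le unorm_ge0 andbT t0.
  rewrite -t0 uadj0 !(mulr0, mul0r, scale0r, addr0, subr0); exact: upos0.
have ggpos : upos ((t ^+ 2)%:C%:A - uadj g * g).
  split; first by rewrite uadjB uadjZr uadj1 uadjM uadjK.
  exists (t ^+ 2); first exact: sqr_ge0.
  rewrite subKr; have := unormM (uadj g) g; rewrite unorm_uadj.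
  have := unorm_ge0 g; nra.
have [w [[wsa _] ww _]] := upos_sqrt _ ggpos.
rewrite -(scaleVr t (_ - _)) // scalerA mulrC -scalerA.
apply: uposZ; first by rewrite invr_ge0 ltW.
have := uposD _ _ (upos_uadjM (t%:C *: x - g * y)) (upos_uadjM (w * y)).
congr upos.
have -> : uadj (w * y) * (w * y) =
    (t ^+ 2)%:C *: (uadj y * y) - uadj y * uadj g * g * y.
  have -> : uadj (w * y) * (w * y) = uadj y * (w * w) * y.
    by rewrite uadjM wsa !mulrA.
  by rewrite ww mulrBr mulrBl -scalerAr -scalerAl mulr1 !mulrA.
rewrite uadjB uadjZr uadjM !(mulrDl, mulrDr, mulrN, mulNr).
rewrite -!scalerAl -!scalerAr !mulrA !scalerDr !scalerA -!rmorphM expr2; module.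
Qed.

End UnitalCStarTheory.

Section Schur.
Context {R : realType} {U : unitalCStarType R}.

Lemma upos_sum (I : finType) (F : I -> U) :
  (forall i, upos (F i)) -> upos (\sum_i F i).
Proof. by move=> Fpos; elim/big_ind: _ => //; [exact: upos0|exact: uposD]. Qed.

(** The double sum of the inequalities [upos_cross] with t = |G i j| gives twice
    the form S on one side and, |G i j| being symmetric, twice the sum of the
    row sums times e_i* e_i on the other. *)
Lemma schur_test (n : nat) (e : 'I_n -> U) (G : 'I_n -> 'I_n -> U) (M : R) :
  (forall i j, uadj (G i j) = G j i) -> (forall i, \sum_j unorm (G i j) <= M) ->
  upos (M%:C *: (\sum_i uadj (e i) * e i)
        - \sum_i \sum_j uadj (e i) * G i j * e j).
Proof.
move=> Gsa GM; pose g i j := unorm (G i j).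
have gC i j : g i j = g j i by rewrite /g -Gsa unorm_uadj.
set S := \sum_i \sum_j _.
pose P := \sum_i \sum_j (g i j)%:C *: (uadj (e i) * e i).
have cross := upos_sum _ _ (fun i => upos_sum _ _
  (fun j => upos_cross (G i j) (e i) (e j) _ (lexx (g i j)))).
have crossE : \sum_i \sum_j
    ((g i j)%:C *: (uadj (e i) * e i) + (g i j)%:C *: (uadj (e j) * e j)
     - (uadj (e i) * G i j * e j + uadj (e j) * uadj (G i j) * e i)) =
    P + P - (S + S).
  under eq_bigr do rewrite sumrB !big_split /=.
  rewrite sumrB !big_split /=; congr (_ + _ - (_ + _)).
    rewrite exchange_big; apply: eq_bigr => i _; apply: eq_bigr => j _.
    by rewrite gC.
  rewrite exchange_big; apply: eq_bigr => i _; apply: eq_bigr => j _.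
  by rewrite Gsa.
have rest : upos (\sum_i (M - \sum_j g i j)%:C *: (uadj (e i) * e i)).
  by apply: upos_sum => i; apply: uposZ; [rewrite subr_ge0 GM|exact: upos_uadjM].
have restE : \sum_i (M - \sum_j g i j)%:C *: (uadj (e i) * e i) =
    M%:C *: (\sum_i uadj (e i) * e i) - P.
  rewrite scaler_sumr -sumrB; apply: eq_bigr => i _.
  by rewrite rmorphB scalerBl rmorph_sum scaler_suml.
rewrite crossE in cross; rewrite restE in rest.
have h0 : 0 <= (2^-1 : R) by lra.
have := uposD _ _ (uposZ _ _ h0 cross) rest; congr upos.
have -> : P + P - (S + S) = 2%:C *: (P - S).
  have -> : (2 : R)%:C = 2%:R by rewrite rmorph_nat.
  by module.
rewrite scalerA -rmorphM; have -> : (2^-1 * 2 : R) = 1 by lra.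
by rewrite scale1r; module.
Qed.

End Schur.

(** * The unitization *)

Definition unitization (R : realType) (A : cstarAlgebraType R) : Type :=
  (A * R[i])%type.

Section UnitizationRing.
Context {R : realType} {A : cstarAlgebraType R}.
Local Notation U := (unitization R A).
Implicit Types (a b x y : A) (p q : U).

HB.instance Definition _ := GRing.Lmodule.copy U (A * R[i])%type.

Lemma cmul0l a : cmul 0 a = 0 :> A.
Proof. by rewrite -(scale0r (0 : A)) cmulZl !scale0r. Qed.

Lemma cmul0r a : cmul a 0 = 0 :> A.
Proof. by rewrite -(scale0r (0 : A)) cmulZr !scale0r. Qed.

Let mul : U -> U -> U := @unitization_mul R A.

Lemma unitization_mulA : associative mul.
Proof.
move=> [a l] [b m] [c k]; rewrite /mul /unitization_mul /=; congr pair;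
  last by rewrite mulrA.
rewrite !(cmulDl, cmulDr, cmulZl, cmulZr) cmulA; module.
Qed.

Lemma unitization_mul1l : left_id ((0, 1) : U) mul.
Proof.
move=> [a l]; rewrite /mul /unitization_mul /= cmul0l scaler0 scale1r add0r addr0 mul1r //.
Qed.

Lemma unitization_mul1r : right_id ((0, 1) : U) mul.
Proof.
move=> [a l]; rewrite /mul /unitization_mul /= cmul0r scaler0 scale1r add0r add0r mulr1 //.
Qed.

Lemma unitization_mulDl : left_distributive mul +%R.
Proof.
move=> [a l] [b m] [c k]; rewrite /mul /unitization_mul /=; congr pair;
  last by rewrite /= mulrDl.
rewrite /= cmulDl; module.
Qed.

Lemma unitization_mulDr : right_distributive mul +%R.
Proof.
move=> [a l] [b m] [c k]; rewrite /mul /unitization_mul /=; congr pair;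
  last by rewrite /= mulrDr.
rewrite /= cmulDr; module.
Qed.

Lemma unitization_1_neq0 : ((0, 1) : U) != 0.
Proof. by apply/eqP => -[] /eqP; rewrite oner_eq0. Qed.

HB.instance Definition _ := GRing.Zmodule_isNzRing.Build U
  unitization_mulA unitization_mul1l unitization_mul1r
  unitization_mulDl unitization_mulDr unitization_1_neq0.

Lemma unitization_scaleAl (k : R[i]) p q : k *: (p * q) = (k *: p) * q.
Proof.
case: p q => [a l] [b m]; congr pair => /=; last exact: mulrA.
rewrite cmulZl -[k *: l]/(k * l); module.
Qed.

HB.instance Definition _ := GRing.Lmodule_isLalgebra.Build R[i] U unitization_scaleAl.

Lemma unitization_scaleAr (k : R[i]) p q : k *: (p * q) = p * (k *: q).
Proof.
case: p q => [a l] [b m]; congr pair => /=; last exact: mulrCA.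
rewrite cmulZr -[k *: m]/(k * m); module.
Qed.

HB.instance Definition _ := GRing.Lalgebra_isAlgebra.Build R[i] U unitization_scaleAr.
End UnitizationRing.

Section UnitizationNorm.
Context {R : realType} {A : cstarAlgebraType R}.
Local Notation U := (unitization R A).
Implicit Types (a b x y : A) (p q : U).

Definition unitization_act p x : A := cmul p.1 x + p.2 *: x.

(** The bounds of the norm max(|l|, |L|) of (a, l), with L the operator
    x |-> a x + l x on A.  The operator norm alone would not separate points if
    A has a unit 1: the operator of (1, -1) vanishes. *)
Definition unitization_bound p : set R := [set t | [/\ 0 <= t, rnorm p.2 <= t
  & forall x, rnorm (unitization_act p x) <= t * rnorm x]]%classic.

Definition unitization_norm p : R := inf (unitization_bound p).
Definition unitization_star p : U := (cstar p.1, (p.2^*)%R).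

Lemma rnorm_cmul a b : rnorm (cmul a b) <= rnorm a * rnorm b.
Proof. by have := norm_cmul a b; rewrite !rnormE -rmorphM lecR. Qed.

Lemma rnorm_cstarM a : rnorm (cmul (cstar a) a) = rnorm a ^+ 2.
Proof. by have := norm_cstarM a; rewrite !rnormE -rmorphXn => -[]. Qed.

Lemma rnorm_cstar a : rnorm (cstar a) = rnorm a.
Proof.
suff le b : rnorm b <= rnorm (cstar b).
  by apply/eqP; rewrite eq_le le -{2}(cstarK a) le.
have := rnorm_cstarM b; have := rnorm_cmul (cstar b) b.
have := rnorm_ge0 b; rewrite le_eqVlt => /predU1P[<-|b0]; first by rewrite rnorm_ge0.
by move=> h1 h2; rewrite -(ler_pM2r b0) -expr2 -h2.
Qed.

Lemma unitization_bound_fst p : unitization_bound p (rnorm p.1 + rnorm p.2).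
Proof.
have n1 := rnorm_ge0 p.1; have n2 := rnorm_ge0 p.2; split; [lra|lra|move=> x].
have := rnormD (cmul p.1 x) (p.2 *: x); have := rnorm_cmul p.1 x.
rewrite rnormZ /unitization_act; lra.
Qed.

Lemma unitization_bound_has_inf p : has_inf (unitization_bound p).
Proof.
by split; [exists (rnorm p.1 + rnorm p.2); exact: unitization_bound_fst|exists 0 => t []].
Qed.

Lemma unitization_norm_le p t : unitization_bound p t -> unitization_norm p <= t.
Proof. by move=> h; apply: ge_inf => //; case: (unitization_bound_has_inf p). Qed.

Lemma unitization_norm_bound p : unitization_bound p (unitization_norm p).
Proof.
have [S0 Slb] := unitization_bound_has_inf p.
split.
- by apply: lb_le_inf => // t [].
- by apply: lb_le_inf => // t [].
move=> x; have [x0|x0] := eqVneq (rnorm x) 0.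
  by rewrite (rnorm_eq0 _ x0) /unitization_act cmul0r scaler0 addr0 rnorm0 mulr0.
have xp : 0 < rnorm x by rewrite lt_def x0 rnorm_ge0.
rewrite -ler_pdivrMr //; apply: lb_le_inf => // t [_ _ h].
by rewrite ler_pdivrMr.
Qed.

Lemma unitization_norm_ge0 p : 0 <= unitization_norm p.
Proof. by case: (unitization_norm_bound p). Qed.

Lemma unitization_norm_snd p : rnorm p.2 <= unitization_norm p.
Proof. by case: (unitization_norm_bound p). Qed.

Lemma unitization_norm_act p x :
  rnorm (unitization_act p x) <= unitization_norm p * rnorm x.
Proof. by case: (unitization_norm_bound p). Qed.

(** The operator of (a, l) at a* is a a* + l a*, and |a a*| = |a|^2. *)
Lemma unitization_norm_fst p : rnorm p.1 <= 2 * unitization_norm p.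
Proof.
have := unitization_norm_act p (cstar p.1); rewrite rnorm_cstar.
have E : cmul p.1 (cstar p.1) = unitization_act p (cstar p.1) + - (p.2 *: cstar p.1).
  by rewrite /unitization_act; module.
have := rnorm_cstarM (cstar p.1); rewrite cstarK rnorm_cstar E.
have := rnormD (unitization_act p (cstar p.1)) (- (p.2 *: cstar p.1)).
rewrite rnormN rnormZ rnorm_cstar.
have := unitization_norm_snd p; have := rnorm_ge0 p.1.
have := unitization_norm_ge0 p; nra.
Qed.

Lemma unitization_act_mul p q x :
  unitization_act (p * q) x = unitization_act p (unitization_act q x).
Proof.
case: p q => [a l] [b m]; rewrite /unitization_act /=.
rewrite !(cmulDl, cmulDr, cmulZl, cmulZr) cmulA; module.
Qed.

Lemma cmul_unitization_act p x y :
  cmul (cstar (unitization_act p x)) y =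
  cmul (cstar x) (unitization_act (unitization_star p) y).
Proof.
by rewrite /unitization_act cstarD cstarZ cstarM cmulDl cmulDr cmulZl cmulZr cmulA.
Qed.

Lemma unitization_starK p : unitization_star (unitization_star p) = p.
Proof. by case: p => a l; congr pair; rewrite /= ?cstarK ?conjCK. Qed.

Lemma unitization_starD p q :
  unitization_star (p + q) = unitization_star p + unitization_star q.
Proof. by congr pair; rewrite /= ?cstarD // rmorphD. Qed.

Lemma unitization_starZ (l : R[i]) p :
  unitization_star (l *: p) = (l^*)%R *: unitization_star p.
Proof. by congr pair; rewrite /= ?cstarZ // rmorphM. Qed.

Lemma unitization_starM p q :
  unitization_star (p * q) = unitization_star q * unitization_star p.
Proof.
congr pair; rewrite /= ?rmorphM 1?mulrC //.
rewrite !cstarD !cstarZ cstarM; module.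
Qed.

Lemma unitization_norm_eq0 p : unitization_norm p = 0 -> p = 0.
Proof.
move=> p0; have := unitization_norm_fst p; have := unitization_norm_snd p.
rewrite p0 mulr0 => h2 h1; case: p {p0} h1 h2 => a l /= h1 h2.
by congr pair; apply: rnorm_eq0; apply/eqP; rewrite eq_le rnorm_ge0 andbT.
Qed.

Lemma unitization_normD p q :
  unitization_norm (p + q) <= unitization_norm p + unitization_norm q.
Proof.
apply: unitization_norm_le; split; first by rewrite addr_ge0 ?unitization_norm_ge0.
  by apply: le_trans (rnormD _ _) _; rewrite lerD ?unitization_norm_snd.
move=> x.
have -> : unitization_act (p + q) x = unitization_act p x + unitization_act q x.
  by rewrite /unitization_act /= cmulDl; module.
by apply: le_trans (rnormD _ _) _; rewrite mulrDl lerD ?unitization_norm_act.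
Qed.

Lemma unitization_normZ_le (l : R[i]) p :
  unitization_norm (l *: p) <= rnorm l * unitization_norm p.
Proof.
apply: unitization_norm_le; split.
- by rewrite mulr_ge0 ?unitization_norm_ge0 ?rnorm_ge0.
- by rewrite /= rnormM ler_wpM2l ?unitization_norm_snd ?rnorm_ge0.
move=> x; have -> : unitization_act (l *: p) x = l *: unitization_act p x.
  by rewrite /unitization_act /= cmulZl -[l *: p.2]/(l * p.2); module.
by rewrite rnormZ -mulrA ler_wpM2l ?unitization_norm_act ?rnorm_ge0.
Qed.

Lemma unitization_normZ (l : R[i]) p :
  unitization_norm (l *: p) = rnorm l * unitization_norm p.
Proof.
apply/eqP; rewrite eq_le unitization_normZ_le /=.
have [->|l0] := eqVneq l 0; first by rewrite rnorm0 mul0r unitization_norm_ge0.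
have := unitization_normZ_le l^-1 (l *: p); rewrite scalerA mulVf // scale1r => h.
have lV : rnorm l * rnorm l^-1 = 1.
  by rewrite -rnormM mulfV // rnormC_real normr1.
by have := ler_wpM2l (rnorm_ge0 l) h; rewrite mulrA lV mul1r.
Qed.

Lemma unitization_normM p q :
  unitization_norm (p * q) <= unitization_norm p * unitization_norm q.
Proof.
apply: unitization_norm_le; split; first by rewrite mulr_ge0 ?unitization_norm_ge0.
  by rewrite /= rnormM ler_pM ?unitization_norm_snd ?rnorm_ge0.
move=> x; rewrite unitization_act_mul; apply: le_trans (unitization_norm_act _ _) _.
by rewrite -mulrA ler_wpM2l ?unitization_norm_act ?unitization_norm_ge0.
Qed.

(** For the operator part, |p x|^2 = |(p x)* (p x)| = |x* (p* p x)|, which is at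
    most |p* p| |x|^2. *)
Lemma unitization_norm_starM p :
  unitization_norm p ^+ 2 <= unitization_norm (unitization_star p * p).
Proof.
set T := unitization_norm (unitization_star p * p).
have T0 : 0 <= T by exact: unitization_norm_ge0.
rewrite -[leRHS]sqr_sqrtr //.
rewrite ler_sqr ?nnegrE ?sqrtr_ge0 ?unitization_norm_ge0 //.
apply: unitization_norm_le; split; first exact: sqrtr_ge0.
  have := unitization_norm_snd (unitization_star p * p).
  rewrite -/T /= rnormM rnorm_conj -expr2 => h.
  by rewrite -ler_sqr ?nnegrE ?sqrtr_ge0 ?rnorm_ge0 // sqr_sqrtr.
move=> x; rewrite -ler_sqr ?nnegrE ?mulr_ge0 ?sqrtr_ge0 ?rnorm_ge0 //.
rewrite exprMn sqr_sqrtr // -rnorm_cstarM.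
rewrite cmul_unitization_act -unitization_act_mul.
have := rnorm_cmul (cstar x) (unitization_act (unitization_star p * p) x).
rewrite rnorm_cstar.
have := unitization_norm_act (unitization_star p * p) x; rewrite -/T.
have := rnorm_ge0 x; nra.
Qed.

Lemma unitization_norm_sub p q :
  [/\ rnorm (p.1 - q.1) <= 2 * unitization_norm (p - q),
  `|complex.Re p.2 - complex.Re q.2| <= unitization_norm (p - q)
  & `|complex.Im p.2 - complex.Im q.2| <= unitization_norm (p - q)].
Proof.
have h := unitization_norm_snd (p - q).
split; first exact: (unitization_norm_fst (p - q)).
  apply: le_trans h; apply: le_trans (rnorm_Re _).
  by case: p q => a [l1 l2] [b [m1 m2]].
apply: le_trans h; apply: le_trans (rnorm_Im _).
by case: p q => a [l1 l2] [b [m1 m2]].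
Qed.

End UnitizationNorm.

Lemma cauchy_seq_lim (K : numFieldType) (V : completeNormedModType K) (u : nat -> V) :
  (forall e : K, 0 < e -> exists N, forall m n,
       (N <= m)%N -> (N <= n)%N -> `|u m - u n| <= e) ->
  exists l, forall e : K, 0 < e -> exists N, forall n,
       (N <= n)%N -> `|u n - l| <= e.
Proof.
move=> uC; have : cvg (u @ \oo)%classic.
  apply: cauchy_cvg; apply/cauchy_ballP => e e0.
  have [N hN] := uC (e / 2) (divr_gt0 e0 (ltr0n _ 2)).
  exists (u @` [set n | (N <= n)%N], u @` [set n | (N <= n)%N])%classic => /=.
    by split; exists N => // n Nn; exists n.
  move=> [_ _] [/= [m Nm <-] [n Nn <-]].
  rewrite -ball_normE /ball_ /=; apply: le_lt_trans (hN _ _ Nm Nn) _.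
  by rewrite ltr_pdivrMr // ltr_pMr // ltr1n.
move=> /cvg_ex[l /cvgrPdist_le ul]; exists l => e e0.
have [N _ hN] := ul e e0; exists N => n Nn; rewrite distrC; exact: hN.
Qed.

Section UnitizationCStar.
Context {R : realType} {A : cstarAlgebraType R}.
Local Notation U := (unitization R A).

Lemma rnorm_le_ReIm (l : R[i]) : rnorm l <= `|complex.Re l| + `|complex.Im l|.
Proof.
have {1}-> : l = (complex.Re l)%:C + 'i * (complex.Im l)%:C by exact: complexE.
apply: le_trans (rnormD _ _) _; rewrite rnormM !rnormC_real.
by rewrite /rnorm normc_def /= expr0n add0r expr1n sqrtr1 mul1r.
Qed.

Lemma unitization_complete (u : nat -> U) :
  (forall e, 0 < e -> exists N, forall m n,
     (N <= m)%N -> (N <= n)%N -> unitization_norm (u m - u n) <= e) ->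
  exists l : U, forall e, 0 < e -> exists N, forall n,
     (N <= n)%N -> unitization_norm (u n - l) <= e.
Proof.
move=> uC.
have [a ha] : exists a : A, forall e : R[i], 0 < e -> exists N, forall n,
    (N <= n)%N -> `|(u n).1 - a| <= e.
  apply: cauchy_seq_lim => -[e e']; rewrite ltcE /= => /andP[/eqP-> e0].
  have e20 : 0 < e / 2 by lra.
  have [N hN] := uC _ e20; exists N => m n Nm Nn.
  have [h _ _] := unitization_norm_sub (u m) (u n); rewrite rnormE lecR.
  by have := hN m n Nm Nn; lra.
have [x hx] : exists x : R^o, forall e : R, 0 < e -> exists N, forall n,
    (N <= n)%N -> `|(complex.Re (u n).2 : R^o) - x| <= e.
  apply: cauchy_seq_lim => e e0; have [N hN] := uC e e0; exists N => m n Nm Nn.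
  by have [_ h _] := unitization_norm_sub (u m) (u n); apply: le_trans h _; exact: hN.
have [y hy] : exists y : R^o, forall e : R, 0 < e -> exists N, forall n,
    (N <= n)%N -> `|(complex.Im (u n).2 : R^o) - y| <= e.
  apply: cauchy_seq_lim => e e0; have [N hN] := uC e e0; exists N => m n Nm Nn.
  by have [_ _ h] := unitization_norm_sub (u m) (u n); apply: le_trans h _; exact: hN.
exists (a, x +i* y) => e e0; have e30 : 0 < e / 3 by lra.
have e30C : 0 < (e / 3)%:C by rewrite ltcR.
have [N1 h1] := ha _ e30C; have [N2 h2] := hx _ e30; have [N3 h3] := hy _ e30.
exists (maxn N1 (maxn N2 N3)) => n; rewrite !geq_max => /and3P[n1 n2 n3].
apply: le_trans (unitization_norm_le _ _ (unitization_bound_fst _)) _.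
have := h1 n n1; rewrite rnormE lecR => {}h1.
have := rnorm_le_ReIm (u n - (a, x +i* y)).2.
have -> : complex.Re (u n - (a, x +i* y)).2 = complex.Re (u n).2 - x.
  by case: (u n) => b [].
have -> : complex.Im (u n - (a, x +i* y)).2 = complex.Im (u n).2 - y.
  by case: (u n) => b [].
have := h2 n n2; have := h3 n n3; rewrite -[(u n - _).1]/((u n).1 - a); lra.
Qed.

HB.instance Definition _ := isUnitalCStarAlgebra.Build R U
  unitization_star unitization_norm
  unitization_starK unitization_starD unitization_starZ unitization_starM
  unitization_norm_eq0 unitization_normD
  unitization_normZ unitization_normM unitization_norm_starM unitization_complete.

(** * Positivity in A and in its unitization *)

Definition emb (a : A) : U := (a, 0).

Lemma embD a b : emb (a + b) = emb a + emb b.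
Proof. by congr pair; rewrite /= addr0. Qed.

Lemma emb0 : emb 0 = 0. Proof. by []. Qed.

Lemma embN a : emb (- a) = - emb a.
Proof. by congr pair; rewrite /= oppr0. Qed.

Lemma embZ (l : R[i]) a : emb (l *: a) = l *: emb a.
Proof. by congr pair; exact/esym/mulr0. Qed.

Lemma embM a b : emb (cmul a b) = emb a * emb b.
Proof. by congr pair; rewrite /= ?scale0r ?addr0 // mulr0. Qed.

Lemma emb_star a : emb (cstar a) = uadj (emb a).
Proof. by congr pair; rewrite /= rmorph0. Qed.

Lemma emb_sum (I : finType) (F : I -> A) : emb (\sum_i F i) = \sum_i emb (F i).
Proof. by apply: (big_morph emb embD emb0). Qed.

Lemma emb_norm a : unorm (emb a) <= rnorm a.
Proof.
have := unitization_norm_le _ _ (unitization_bound_fst (emb a)).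
by rewrite /= rnorm0 addr0.
Qed.

Lemma scalar1E (l : R[i]) : (l *: 1 : U) = (0, l).
Proof. by congr pair; [exact: scaler0|exact: mulr1]. Qed.

Lemma cspectrum_emb a l : cspectrum a l <-> ~ invertible (emb a - l%:A).
Proof. by rewrite scalar1E -[emb a - _]/(a + - 0, 0 + - l) oppr0 addr0 add0r. Qed.

Lemma cpositive_emb a : cpositive a <-> upos (emb a).
Proof.
split=> [[asa aspec]|apos].
  apply: upos_of_invertible; first by rewrite -emb_star asa.
  move=> r r0; apply: contrapT => ninv.
  have /aspec : cspectrum a (- r%:C).
    by apply/cspectrum_emb; rewrite scaleNr opprK.
  by rewrite oppr_ge0 lecR leNgt r0.
have [asa _] := apos; split; first by move: asa; rewrite -emb_star => -[].
move=> l /cspectrum_emb ninv; apply: contrapT => nl; apply: ninv.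
case: l nl => x y; rewrite lecE /= eq_sym => nl.
have [y0|y0] := eqVneq y 0.
  have x0 : 0 < - x.
    by rewrite oppr_gt0 ltNge; apply/negP => x0; apply: nl; rewrite y0 eqxx.
  have := upos_invertible _ _ x0 apos.
  by rewrite y0 rmorphN scaleNr.
have -> : emb a - (x +i* y)%:A = (emb a - x%:C%:A) + ('i * (- y)%:C)%:A.
  by rewrite [x +i* y]complexE /= rmorphN; module.
apply: sa_invertible_im; last by rewrite oppr_eq0.
by rewrite uadjB uadjZr uadj1 asa.
Qed.

(** The square root is taken in the unitization; it lies in A, since the square
    of its scalar part is the scalar part of the given element, namely 0. *)
Lemma csquare_csqrt (a : A) : cpositive a -> csquare (csqrt a) = a :> A.
Proof.
move=> /cpositive_emb /upos_sqrt[[b m] [bpos bb _]].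
suff : exists b, cpositive b /\ csquare b = a by move=> /xgetPex h; case: (h 0).
move: bb bpos => [] + /eqP; rewrite mulf_eq0 orbb => + /eqP m0.
rewrite m0 !scale0r !addr0 => bb bpos; exists b; split=> //.
exact/cpositive_emb.
Qed.

Lemma cpositive_cstarM (a : A) : cpositive (cmul (cstar a) a).
Proof. by apply/cpositive_emb; rewrite embM emb_star; apply: upos_uadjM. Qed.

End UnitizationCStar.

(** * The Hilbert module inequality *)

Section InnerProduct.
Context {R : realType} {A : cstarAlgebraType R} {X : hilbertModuleType A}.
Implicit Types (x y z : X) (a b : A).

Lemma innerDr x y z : inner x (y + z) = inner x y + inner x z.
Proof. by have := innerPr 1 x y z; rewrite !scale1r. Qed.

Lemma inner0r x : inner x 0 = 0 :> A.
Proof. by apply: (addrI (inner x 0)); rewrite -innerDr !addr0. Qed.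

Lemma inner_sumr (I : finType) x (F : I -> X) :
  inner x (\sum_i F i) = \sum_i inner x (F i).
Proof. by apply: big_morph; [exact: innerDr|exact: inner0r]. Qed.

Lemma inner_suml (I : finType) x (F : I -> X) :
  inner (\sum_i F i) x = \sum_i inner (F i) x.
Proof.
apply: (big_morph (fun z => inner z x)) => [z t|].
  by rewrite -inner_star innerDr cstarD !inner_star.
by rewrite -inner_star inner0r -(scale0r (0 : A)) cstarZ rmorph0 !scale0r.
Qed.

Lemma inner_ractl x y a : inner (ract x a) y = cmul (cstar a) (inner x y).
Proof. by rewrite -inner_star inner_ract cstarM inner_star. Qed.

End InnerProduct.

Theorem theorem3p3 (R : realType) (A : cstarAlgebraType R)
    (X : hilbertModuleType A) (n : nat) (hn : (0 < n)%N) (y : 'I_n -> X) :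
  forall a : 'I_n -> A,
    cle (csquare (habs (\sum_(i < n) ract (y i) (a i))))
        ((\big[Num.max/0]_(i < n) \sum_(j < n) `|inner (y i) (y j)|)
           *: \sum_(i < n) csquare (cabs (a i))).
Proof.
move=> a.
pose m i : R := \sum_(j < n) rnorm (inner (y i) (y j)).
(* The maximum is computed in the complex field, which is only partially
   ordered; its terms are real, so it is the image of a real maximum. *)
have maxE : \big[Num.max/0]_(i < n) \sum_(j < n) `|inner (y i) (y j)| =
    (\big[Num.max/0]_(i < n) m i)%:C.
  rewrite (big_morph (real_complex R) (op1 := Num.max) (id1 := 0)) //; last first.
    by move=> r s; rewrite !maxEle lecR; case: ifP.
  apply: eq_bigr => i _; rewrite rmorph_sum; apply: eq_bigr => j _; exact: rnormE.
rewrite maxE /habs csquare_csqrt; last exact: inner_ge0.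
under [X in _ *: X]eq_bigr => i _
  do rewrite /cabs (csquare_csqrt _ (cpositive_cstarM _)).
apply/cpositive_emb; set M := \big[_/_]_(i < n) m i.
have GM i : \sum_j unorm (emb (inner (y i) (y j))) <= M.
  apply: le_trans (le_bigmax _ m i); apply: ler_sum => j _; exact: emb_norm.
have Gstar i j : uadj (emb (inner (y i) (y j))) = emb (inner (y j) (y i)).
  by rewrite -emb_star inner_star.
have := schur_test n (fun i => emb (a i)) _ M Gstar GM; congr upos.
rewrite embD embN embZ emb_sum inner_suml emb_sum.
congr (_ *: _ - _); apply: eq_bigr => i _; first by rewrite embM emb_star.
rewrite inner_ractl embM emb_star inner_sumr emb_sum mulr_sumr.
by apply: eq_bigr => j _; rewrite inner_ract embM mulrA.
Qed.
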